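(* Let $b > 1$ be a real number, let $n$ be a positive integer, and let $n_0 = \lceil \log_b(1+\frac{1}{b}) \rceil$. Then $|c_{i,j,n}| \leq |c_{n_0,n_0,n}|$ for all integers $i, j$ with $n_0 \leq i, j < n$. Hence $M_b(n) \in \{ |c_{i,j,n}| : 0 \leq i, j \leq n_0,\ i,j < n \}$.
   Context: For real numbers $a_0, \ldots, a_{n-1}$, $V(a_0, \ldots, a_{n-1})$ denotes the $n \times n$ Vandermonde matrix whose $(i,j)$ entry ($0 \leq i,j < n$, rows and columns indexed from $0$) is $a_i^j$. For a positive integer $n$ and a real number $b > 1$, the numbers $c_{i,j,n}$ ($0 \leq i,j < n$), depending on $b$, are the entries of the inverse matrix: $[c_{i,j,n}]_{0 \leq i,j < n} = V(b^0, b^1, \ldots, b^{n-1})^{-1}$, i.e. the inverse of $[b^{ij}]_{0 \leq i,j<n}$. Further, $M_b(n) = \max_{0 \leq i,j < n} |c_{i,j,n}|$. *)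

(* Defs.v *)
From mathcomp Require Import all_boot all_order all_algebra.
From mathcomp Require Import all_classical all_reals all_analysis.

Set Implicit Arguments.
Unset Strict Implicit.
Unset Printing Implicit Defensive.

Import Order.TTheory GRing.Theory Num.Theory.
Local Open Scope ring_scope.

(* V(a_0, ..., a_(n-1)) has (i, j) entry a_i ^+ j, whereas the library's
   Vandermonde has (i, j) entry a_j ^+ i: hence the transpose. *)
Definition vdm (R : realType) (n : nat) (a : 'rV[R]_n) : 'M[R]_n :=
  (Vandermonde n a)^T.

Definition geomvdm (R : realType) (b : R) (n : nat) : 'M[R]_n :=
  vdm (\row_(i < n) b ^+ i).

(* invmx is the true inverse only on invertible matrices; for b > 1 this is
   the case by geomvdm_unit below. *)
Definition c (R : realType) (b : R) (n : nat) (i j : 'I_n) : R :=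
  invmx (geomvdm b n) i j.

(* The default value 0 is harmless: the entries are nonnegative, and n > 0
   wherever this is used. *)
Definition maxc (R : realType) (b : R) (n : nat) : R :=
  \big[Num.max/0]_(i < n) \big[Num.max/0]_(j < n) `|c b i j|.

Definition logb (R : realType) (b x : R) : R := ln x / ln b.

(* Num.ceil is int-valued; for b > 1 it is nonnegative here (ceil_logb_ge0),
   so that the absolute value only casts it to nat. *)
Definition n0 (R : realType) (b : R) : nat :=
  `|Num.ceil (logb b (1 + b^-1))|%N.

Lemma geomvdm_unit (R : realType) (b : R) (n : nat) :
  1 < b -> geomvdm b n \in unitmx.
Proof.
move=> b1; rewrite unitmx_tr unitmxE det_Vandermonde unitfE.
apply/prodf_neq0 => i _; apply/prodf_neq0 => j ij.
by rewrite !mxE subr_eq0 (inj_eq (ieexprIn _ _)) ?gtn_eqF ?gt_eqF //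
           (lt_trans ltr01).
Qed.

Lemma ceil_logb_ge0 (R : realType) (b : R) :
  1 < b -> 0 <= Num.ceil (logb b (1 + b^-1)).
Proof.
move=> b1; have b0 : 0 < b by rewrite (lt_trans ltr01).
rewrite -(ler_int R) (le_trans _ (ceil_ge _)) // /logb.
by rewrite divr_ge0 // ln_ge0 ?(ltW b1) // lerDl invr_ge0 ltW.
Qed.

(* Main.v *)
(* Column j of the inverse holds the coefficients of the j-th Lagrange
   polynomial at the nodes b^k, so that |c_{i,j,n}| = N_j / D_j with N_j the
   coefficient of x^i in the product of the x + b^k, k <> j, and D_j the product
   of the |b^j - b^k|, k <> j.  N_j decreases with j, while D_j <= D_{j+1} as
   soon as 1 + 1/b <= b^j, i.e. n_0 <= j.  Hence every row is nonincreasing in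
   absolute value from column n_0 on, and so is every column since the matrix
   is symmetric. *)

Require Import Defs.
From mathcomp Require Import all_boot all_order all_algebra.
From mathcomp Require Import all_classical all_reals all_analysis.
From mathcomp Require Import zify ring lra.

Import Order.TTheory GRing.Theory Num.Theory.
Local Open Scope ring_scope.

(** The coefficients of a product of ['X - a k] with nonnegative [a k] alternate in sign. *)
Lemma norm_coef_prod_XsubC (R : realDomainType) (I : Type) (r : seq I)
    (P : pred I) (a : I -> R) (i : nat) :
  (forall k, P k -> 0 <= a k) ->
  `|(\prod_(k <- r | P k) ('X - (a k)%:P))`_i|
    = (\prod_(k <- r | P k) ('X + (a k)%:P))`_i.
Proof.
move=> a0.
(* Here [m] counts the factors; [m + i] has the parity of [m - i] and avoids truncated
   subtraction. *)
have [m pq] : exists m, forall i,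
    (\prod_(k <- r | P k) ('X - (a k)%:P))`_i
      = (-1) ^+ (m + i) * (\prod_(k <- r | P k) ('X + (a k)%:P))`_i
    /\ 0 <= (\prod_(k <- r | P k) ('X + (a k)%:P))`_i.
  apply: (big_rec2 (fun p q : {poly R} => exists m, forall i,
    p`_i = (-1) ^+ (m + i) * q`_i /\ 0 <= q`_i)).
    by exists 0%N => -[|l]; rewrite !coef1 /= ?expr0 ?mulr1 ?mulr0 //.
  move=> k p q Pk [m IH]; exists m.+1 => l.
  rewrite mulrBl mulrDl coefB coefD !coefXM !coefCM.
  have [-> q0] := IH l.
  case: l q0 => [|l] q0 /=.
    split; last by rewrite add0r mulr_ge0 ?a0.
    by rewrite !addn0 exprS; ring.
  have [-> q1] := IH l.
  split; last by rewrite addr_ge0 ?mulr_ge0 ?a0.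
  by rewrite addSn !addnS !exprS; ring.
have [-> q0] := pq i.
by rewrite normrM normrX normrN1 expr1n mul1r ger0_norm.
Qed.

Lemma coef_prod_XaddC_ge0 (R : realDomainType) (I : Type) (r : seq I)
    (P : pred I) (a : I -> R) (i : nat) :
  (forall k, P k -> 0 <= a k) ->
  0 <= (\prod_(k <- r | P k) ('X + (a k)%:P))`_i.
Proof. by move=> a0; rewrite -norm_coef_prod_XsubC. Qed.

Section GeometricVandermonde.
Set Implicit Arguments.
Unset Strict Implicit.

Variables (R : realType) (b : R).
Hypothesis b_gt1 : 1 < b.

Let b_gt0 : 0 < b. Proof. exact: lt_trans b_gt1. Qed.

Lemma geomvdmE n (i j : 'I_n) : geomvdm b n i j = b ^+ (i * j).
Proof. by rewrite !mxE exprM. Qed.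

Lemma c_sym n (i j : 'I_n) : c b i j = c b j i.
Proof.
have geomvdm_sym : (geomvdm b n)^T = geomvdm b n.
  by apply/matrixP => k l; rewrite mxE !geomvdmE mulnC.
by rewrite /c -[in LHS]geomvdm_sym -trmx_inv mxE.
Qed.

Lemma expb_inj : injective (GRing.exp b).
Proof. by apply: ieexprIn => //; rewrite gt_eqF. Qed.

Lemma c_lagrange n (i j : 'I_n) :
  c b i j = (\prod_(k < n | k != j) ('X - (b ^+ k)%:P))`_i
            / \prod_(k < n | k != j) (b ^+ j - b ^+ k).
Proof.
pose D (j : 'I_n) := \prod_(k < n | k != j) (b ^+ j - b ^+ k).
pose L (j : 'I_n) := \prod_(k < n | k != j) ('X - (b ^+ k)%:P).
have D_neq0 l : D l != 0.
  apply/prodf_neq0 => k kl.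
  by rewrite subr_eq0 (inj_eq expb_inj) eq_sym.
have size_L l : (size (L l) <= n)%N.
  apply: leq_trans (size_poly_prod_leq _ _) _.
  under eq_bigr => k _ do rewrite size_XsubC.
  rewrite sum_nat_const cardC1 card_ord.
  by have := ltn_ord l; lia.
pose C : 'M[R]_n := \matrix_(k, l) ((L l)`_k / D l).
(* Entry (k, l) of the product is [L l] evaluated at [b ^+ k], divided by [D l]: a Kronecker
   delta. *)
suff GC : geomvdm b n *m C = 1%:M.
  have -> : c b i j = C i j; last by rewrite mxE.
  by rewrite /c -[C](mulKmx (geomvdm_unit n b_gt1)) GC mulmx1.
apply/matrixP => k l; rewrite !mxE.
have -> : \sum_m geomvdm b n k m * C m l = (L l).[b ^+ k] / D l.
  rewrite (horner_coef_wide _ (size_L l)) mulr_suml.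
  by apply: eq_bigr => m _; rewrite geomvdmE mxE exprM; ring.
rewrite horner_prod; have [->|kl] := eqVneq k l.
  rewrite (eq_bigr (fun m : 'I_n => b ^+ l - b ^+ m)) ?(divff (D_neq0 l)) //.
  by move=> m _; rewrite hornerXsubC.
by rewrite (bigD1 k) //= hornerXsubC subrr !mul0r.
Qed.

Lemma norm_c n (i j : 'I_n) :
  `|c b i j| = (\prod_(k < n | k != j) ('X + (b ^+ k)%:P))`_i
               / \prod_(k < n | k != j) `|b ^+ j - b ^+ k|.
Proof.
rewrite c_lagrange normrM normfV normr_prod norm_coef_prod_XsubC //.
by move=> k _; rewrite exprn_ge0 // ltW.
Qed.

(** Up to a common cofactor with nonnegative coefficients, this compares ['X + b ^+ j] with
    ['X + b ^+ j']. *)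
Lemma coef_numerator_le n (j j' : 'I_n) (i : nat) : (j <= j')%N ->
  (\prod_(k < n | k != j') ('X + (b ^+ k)%:P))`_i
    <= (\prod_(k < n | k != j) ('X + (b ^+ k)%:P))`_i.
Proof.
have [->//|jj' le_jj'] := eqVneq j j'.
rewrite (bigD1 j) // [in leRHS](bigD1 j') 1?eq_sym //=.
rewrite [in leRHS](eq_bigl (fun k => (k != j') && (k != j))); last first.
  by move=> k; rewrite andbC.
rewrite !mulrDl !coefD !coefCM lerD2l ler_wpM2r ?ler_weXn2l ?(ltW b_gt1) //.
by apply: coef_prod_XaddC_ge0 => k _; rewrite exprn_ge0 1?ltW.
Qed.

(* Since [b^(j+1) - b^(k+1) = b * (b^j - b^k)], the two products differ only
   in the factor [k = 0] of the second and the factor [k = m] of the first. *)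
Lemma denominator_le m (j : nat) : (j < m)%N -> 1 + b^-1 <= b ^+ j ->
  \prod_(k < m.+1 | k != j :> nat) `|b ^+ j - b ^+ k|
    <= \prod_(k < m.+1 | k != j.+1 :> nat) `|b ^+ j.+1 - b ^+ k|.
Proof.
case: m => // m jm bj.
rewrite big_mkcond big_ord_recr -big_mkcond /= gtn_eqF //=.
rewrite [leRHS]big_mkcond big_ord_recl -big_mkcond /= expr0.
rewrite [leLHS](_ : _ =
    \prod_(k < m.+1 | k != Ordinal jm) `|b ^+ j - b ^+ k| *
    `|b ^+ j - b ^+ m.+1|) //.
rewrite [X in _ <= _ * X](_ : _ =
    \prod_(k < m.+1 | k != Ordinal jm) (b * `|b ^+ j - b ^+ k|)); last first.
  apply: eq_bigr => k _.
  by rewrite /bump /= add1n !exprS -mulrBr normrM gtr0_norm.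
rewrite big_split /= prodr_const cardC1 card_ord /=.
rewrite mulrA mulrC ler_wpM2r ?prodr_ge0 //.
rewrite ler0_norm ?subr_le0 ?ler_weXn2l ?(ltW b_gt1) ?(ltnW jm) //.
rewrite ger0_norm ?subr_ge0 ?exprn_ege1 ?(ltW b_gt1) //.
(* With [m] lowered by one, what remains is [b ^+ m.+1 - b ^+ j <= (b ^+ j.+1 - 1) * b ^+ m]. The
   hypothesis times [b] gives [b <= b ^+ j.+1 - 1], which suffices. *)
have bm : 0 <= b ^+ m by rewrite exprn_ge0 1?ltW.
have bj0 : 0 <= b ^+ j by rewrite exprn_ge0 1?ltW.
have bj1 : b + 1 <= b * b ^+ j.
  by rewrite -(ler_pM2l b_gt0) mulrDr mulr1 divff ?gt_eqF // in bj.
have : b * b ^+ m <= (b * b ^+ j - 1) * b ^+ m by rewrite ler_wpM2r // lerBrDr.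
by rewrite !exprS; lra.
Qed.

(** After taking logarithms, this is the defining property of the ceiling in [n0]. *)
Lemma expr_ge_n0 j : (n0 b <= j)%N -> 1 + b^-1 <= b ^+ j.
Proof.
move=> n0j.
have b1 : 0 < 1 + b^-1 by rewrite addr_gt0 ?invr_gt0.
rewrite -ler_ln ?posrE ?exprn_gt0 // lnXn // -mulr_natl.
rewrite -ler_pdivrMr ?ln_gt0 //.
apply: le_trans (ceil_ge _) _.
rewrite -[j%:R]/(j%:Z%:~R) ler_int.
by rewrite -(gez0_abs (ceil_logb_ge0 b_gt1)) lez_nat.
Qed.

Lemma norm_c_le n (i j j' : 'I_n) : (n0 b <= j)%N -> (j <= j')%N ->
  `|c b i j'| <= `|c b i j|.
Proof.
move=> n0j; case: j' => j' jn /=; elim: j' jn => [|l IH] ln.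
  rewrite leqn0 => /eqP j0.
  by rewrite (_ : j = Ordinal ln) //; apply: val_inj.
rewrite leq_eqVlt => /predU1P[jl|].
  by rewrite (_ : j = Ordinal ln) //; apply: val_inj.
(* It remains to compare the consecutive columns [l] and [l.+1], where [n0 b <= j <= l]. *)
rewrite ltnS => jl; apply: le_trans (IH (ltnW ln) jl).
rewrite !norm_c ler_pM //.
- by apply: coef_prod_XaddC_ge0 => k _; rewrite exprn_ge0 1?ltW.
- by rewrite invr_ge0 prodr_ge0.
- exact: coef_numerator_le.
have denom_gt0 (p : 'I_n) : 0 < \prod_(k < n | k != p) `|b ^+ p - b ^+ k|.
  apply: prodr_gt0 => k kp.
  by rewrite normr_gt0 subr_eq0 (inj_eq expb_inj) eq_sym.
rewrite lef_pV2 ?posrE //.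
case: n i j ln n0j jl {IH denom_gt0} => // m i j ln n0j jl.
exact: denominator_le (expr_ge_n0 (leq_trans n0j jl)).
Qed.

(** Lower the column index first, then the row index by symmetry. *)
Lemma norm_c_le2 n (i i' j j' : 'I_n) :
  (n0 b <= i)%N -> (n0 b <= j)%N -> (i <= i')%N -> (j <= j')%N ->
  `|c b i' j'| <= `|c b i j|.
Proof.
move=> n0i n0j ii' jj'; apply: le_trans (norm_c_le i' n0j jj') _.
by rewrite c_sym [c b i j]c_sym norm_c_le.
Qed.

Lemma maxc_ge n (i j : 'I_n) : `|c b i j| <= maxc b n.
Proof.
apply: le_trans (le_bigmax _ (fun l => `|c b i l|) j) _.
exact: (le_bigmax _ (fun k => \big[Num.max/0]_(l < n) `|c b k l|) i).
Qed.

Lemma maxc_attained n : (0 < n)%N ->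
  exists i j : 'I_n, maxc b n = `|c b i j|.
Proof.
case: n => // n _.
(* A maximum over a nonempty range is attained once the default 0 is below all its terms. *)
rewrite /maxc (bigmax_eq_arg _ ord0) //; last first.
  by move=> i _; exact: bigmax_ge_id.
by eexists; rewrite (bigmax_eq_arg _ ord0) //; eexists.
Qed.

End GeometricVandermonde.

Theorem theorem1 (R : realType) (b : R) (n : nat) (hb : 1 < b)
    (hn : (0 < n)%N) :
  (forall (hn0 : (n0 b < n)%N) (i j : 'I_n),
     (n0 b <= i)%N -> (n0 b <= j)%N ->
     `|c b i j| <= `|c b (Ordinal hn0) (Ordinal hn0)|) /\
  (exists i j : 'I_n,
     [/\ (i <= n0 b)%N, (j <= n0 b)%N & maxc b n = `|c b i j|]).
Proof.
split=> [hn0 i j n0i n0j|]; first exact: norm_c_le2.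
have [i [j maxE]] := maxc_attained b hn.
(* The witnesses are the indices of a maximal entry, capped at [n0 b]; this also covers [n <= n0 b],
   where capping changes nothing. *)
have trunc_lt (k : 'I_n) : (minn k (n0 b) < n)%N.
  exact: leq_ltn_trans (geq_minl _ _) (ltn_ord k).
exists (Ordinal (trunc_lt i)), (Ordinal (trunc_lt j)).
split; rewrite ?geq_minr //; apply/eqP; rewrite eq_le maxc_ge andbT maxE.
have norm_c_trunc k l : `|c b k l| <= `|c b k (Ordinal (trunc_lt l))|.
  case: (boolP (l <= n0 b)%N) => [l_le|]; last rewrite -ltnNge => n0_lt.
    by rewrite (_ : Ordinal (trunc_lt l) = l) //; apply: val_inj; apply/minn_idPl.
  by apply: norm_c_le => //=; rewrite ?geq_minl // leq_min leqnn ltnW.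
(* Cap the column index, then the row index by symmetry. *)
apply: le_trans (norm_c_trunc i j) _.
by rewrite c_sym [in leRHS]c_sym norm_c_trunc.
Qed.
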